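(* Let $E_1,E_2$ be normed spaces and let $T:E_1\times E_2\to Y=L^q(u;I)$ be a bounded bilinear map, where $0<q<\infty$. Suppose that $T^{c,d}=\chi_{(c,d)}T$ is compact for every $a<c<d<b$, and suppose in addition that $$T^{c,d}\in\overline{\mathcal F_2(E_1,E_2;Y)}^{\,\|\cdot\|}\qquad(a<c<d<b).$$ Then $$\operatorname{dist}_{\mathrm{fr}}(T)=\tau(T),$$ and, in the powered metric, with $\vartheta=\min\{1,q\}$, $$d_{\mathrm{fr},\vartheta}(T)=\tau(T)^\vartheta .$$ Moreover, $$\lim_{n\to\infty}a_n^{(2)}(T)=\operatorname{dist}_{\mathrm{fr}}(T)=\tau(T),$$ with the equivalent $\vartheta$-powered identity $\lim_{n\to\infty}a_{n,\vartheta}^{(2)}(T)=d_{\mathrm{fr},\vartheta}(T)=\tau(T)^\vartheta$.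
   Context: Let $-\infty\le a<b\le\infty$ and $I=(a,b)$; $u$ is a nonnegative measurable function on $I$ with $u\in L^1_{\mathrm{loc}}(I)$. $Y=L^q(u;I)$ is the space of (real or complex) measurable functions with $\|h\|_Y=(\int_I|h|^qu\,dx)^{1/q}<\infty$, functions equal $u\,dx$-a.e. being identified. With $\vartheta=\min\{1,q\}$, $Y$ carries the topology of the complete metric $\rho_Y(h,k)=\|h-k\|_Y^\vartheta$. A bilinear map $T:E_1\times E_2\to Y$ is bounded if $\|T\|:=\sup_{\|x_1\|\le1,\|x_2\|\le1}\|T(x_1,x_2)\|_Y<\infty$, and compact if the image of the product of the closed unit balls has compact closure in $Y$. $\mathcal F_2(E_1,E_2;Y)$ is the class of bounded bilinear maps $F$ whose range has finite-dimensional linear span; $\operatorname{rank}F$ is the dimension of that span. The closure $\overline{\,\cdot\,}^{\,\|\cdot\|}$ is taken in the operator (quasi-)norm $\|\cdot\|$ among bounded bilinear maps. Define $\operatorname{dist}_{\mathrm{fr}}(T)=\inf_{F\in\mathcal F_2}\|T-F\|$, $d_{\mathrm{fr},\vartheta}(T)=\inf_{F\in\mathcal F_2}\|T-F\|^\vartheta$, and for $n\ge1$, $a_n^{(2)}(T)=\inf\{\|T-F\|:F\in\mathcal F_2,\ \operatorname{rank}F<n\}$, $a_{n,\vartheta}^{(2)}(T)=\inf\{\|T-F\|^\vartheta:F\in\mathcal F_2,\ \operatorname{rank}F<n\}$. For $a<c<d<b$: $T^{c,d}=\chi_{(c,d)}T$, $\gamma_T(c,d)=\|\chi_{(a,c)\cup(d,b)}T\|$,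 and $\tau(T)=\inf_{a<c<d<b}\gamma_T(c,d)$. *)

(* Defs.v *)
From HB Require Import structures.
From mathcomp Require Export all_boot all_order all_algebra.
From mathcomp Require Export all_classical all_reals all_analysis measurable_realfun complex.
From mathcomp Require Import ring.

Set Implicit Arguments.
Unset Strict Implicit.
Unset Printing Implicit Defensive.

Import Order.TTheory GRing.Theory Num.Theory.
Import numFieldNormedType.Exports.

Local Open Scope classical_set_scope.
Local Open Scope ring_scope.

(* Functions and normed spaces are "real or complex": [k] selects the field. *)
Variant scalars := RealScalars | ComplexScalars.

Definition scalar (R : realType) (k : scalars) : numFieldType :=
  match k with RealScalars => R | ComplexScalars => R[i]%C end.

Definition re_part (R : realType) (k : scalars) : scalar R k -> R :=
  match k with
  | RealScalars => fun z => z
  | ComplexScalars => fun z => complex.Re z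
  end.

Definition im_part (R : realType) (k : scalars) : scalar R k -> R :=
  match k with
  | RealScalars => fun=> 0
  | ComplexScalars => fun z => complex.Im z
  end.

(* In [scalar R k] the norm takes its values in [scalar R k]; [modulus] is the
   same nonnegative number seen in [R]. *)
Definition modulus (R : realType) (k : scalars) (z : scalar R k) : R :=
  re_part `|z|.

Section scalar_theory.
Context (R : realType) (k : scalars).
Implicit Types z w : scalar R k.

Lemma re_partD z w : re_part (z + w) = re_part z + re_part w.
Proof. by case: k z w => [//|] [a b] [c d]. Qed.

Lemma im_partD z w : im_part (z + w) = im_part z + im_part w.
Proof. by case: k z w => [z w|[a b] [c d]//]; rewrite /= addr0. Qed.

Lemma re_partM z w :
  re_part (z * w) = re_part z * re_part w - im_part z * im_part w.
Proof. by case: k z w => [z w|[a b] [c d]//]; rewrite /= mul0r subr0. Qed.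

Lemma im_partM z w :
  im_part (z * w) = re_part z * im_part w + im_part z * re_part w.
Proof. by case: k z w => [z w|[a b] [c d]//]; rewrite /= mulr0 mul0r addr0. Qed.

Lemma re_part0 : re_part (0 : scalar R k) = 0. Proof. by case: k. Qed.

Lemma im_part0 : im_part (0 : scalar R k) = 0. Proof. by case: k. Qed.

Lemma modulusE z : modulus z = Num.sqrt (re_part z ^+ 2 + im_part z ^+ 2).
Proof.
by case: k z => [z|[a b]//]; rewrite /modulus /= expr0n addr0 sqrtr_sqr.
Qed.

Lemma modulus_ge0 z : 0 <= modulus z.
Proof. by rewrite modulusE sqrtr_ge0. Qed.

Lemma modulus0 : modulus (0 : scalar R k) = 0.
Proof. by rewrite modulusE re_part0 im_part0 expr0n addr0 sqrtr0. Qed.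

Lemma modulusM z w : modulus (z * w) = modulus z * modulus w.
Proof.
rewrite !modulusE -sqrtrM ?addr_ge0 ?sqr_ge0//; congr Num.sqrt.
by rewrite re_partM im_partM; ring.
Qed.

Lemma ler_modulusD z w : modulus (z + w) <= modulus z + modulus w.
Proof.
case: k z w => [z w|z w]; first exact: ler_normD.
by have := ler_normD (z : R[i]%C) w; rewrite lecE => /andP[].
Qed.

End scalar_theory.

Definition open_ival (R : realType) (a b : \bar R) : set R :=
  [set x | (a < x%:E)%E /\ (x%:E < b)%E].

Record interval_weight (R : realType) := IntervalWeight {
  lep : \bar R ;
  rep : \bar R ;
  wfun :> R -> R ;
  lep_lt_rep : (lep < rep)%E ;
  wfun_ge0 : forall x, open_ival lep rep x -> 0 <= wfun x ;
  wfun_loc : locally_integrable (open_ival lep rep) wfun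
}.

Definition dom (R : realType) (W : interval_weight R) : set R :=
  open_ival (lep W) (rep W).

Section weighted_measure.
Context (R : realType).
Implicit Types (W : interval_weight R) (a b : \bar R).

Lemma measurable_open_ival a b : measurable (open_ival a b).
Proof.
have -> : open_ival a b = EFin @^-1` [set` `]a, b[%O].
  by apply/seteqP; split=> x /=; rewrite in_itv/= => /andP.
rewrite -[_ @^-1` _]setTI.
have /measurable_EFinP mE : measurable_fun [set: R] (@id R) by [].
by apply: mE => //; exact: emeasurable_itv.
Qed.

Lemma measurable_dom W : measurable (dom W).
Proof. exact: measurable_open_ival. Qed.

Lemma measurable_wfun W : measurable_fun (dom W) W.
Proof. by case: (wfun_loc W). Qed.

Variable W : interval_weight R.

(* The measure [u dx] on [I], extended by zero to the line. *)
Definition wmeasure (A : set R) : \bar R :=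
  (\int[lebesgue_measure]_(x in A) ((W \_ (dom W)) x)%:E)%E.

Let wmeasure0 : wmeasure set0 = 0%E.
Proof. by rewrite /wmeasure integral_set0. Qed.

Let restrict_ge0 x : 0 <= (W \_ (dom W)) x.
Proof. by rewrite patchE; case: ifPn => // /set_mem; exact: wfun_ge0. Qed.

Let wmeasure_ge0 A : (0 <= wmeasure A)%E.
Proof. by apply: integral_ge0 => x _; rewrite lee_fin. Qed.

Let wmeasure_sigma_additive : semi_sigma_additive wmeasure.
Proof.
pose f x := ((W \_ (dom W)) x)%:E.
have := @semi_sigma_additive_nng_induced _ _ R lebesgue_measure f.
rewrite -/wmeasure; apply => [|x]; last by rewrite lee_fin.
apply/measurable_EFinP; apply/(measurable_restrictT _ (measurable_dom W)).
exact: measurable_wfun.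
Qed.

HB.instance Definition _ := isMeasure.Build _ _ _ wmeasure
  wmeasure0 wmeasure_ge0 wmeasure_sigma_additive.

End weighted_measure.

HB.lock Definition Lq_integral (R : realType) (k : scalars)
    (W : interval_weight R) (q : {posnum R})
    (f : R -> (scalar R k)^o) : \bar R :=
  (\int[lebesgue_measure]_(x in dom W)
     (modulus (f x : scalar R k) `^ q%:num * W x)%:E)%E.
Canonical Lq_integral_unlockable := Unlockable Lq_integral.unlock.

Section Lq_functions.
Context (R : realType) (k : scalars) (W : interval_weight R) (q : {posnum R}).
Local Notation K := (scalar R k).
Implicit Types f g : R -> K^o.

Definition scalar_measurable (D : set R) f : Prop :=
  measurable_fun D (fun x => re_part (f x)) /\
  measurable_fun D (fun x => im_part (f x)).

(* Only the values on [I] matter, see [ae_dom_eq] below. *)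
Definition is_Lq f : Prop :=
  scalar_measurable (dom W) f /\ (Lq_integral W q f < +oo)%E.

Definition Lq_pred : {pred R -> K^o} := mem [set f | is_Lq f].

Lemma scalar_measurable_modulus D f : scalar_measurable D f ->
  measurable_fun D (fun x => modulus (f x : K)).
Proof.
move=> [mr mi].
under eq_fun do rewrite modulusE.
apply: measurableT_comp.
  by apply: continuous_measurable_fun; exact: sqrt_continuous.
by apply: measurable_funD; exact: measurable_funX.
Qed.

Lemma measurable_Lq_integrand f : scalar_measurable (dom W) f ->
  measurable_fun (dom W)
    (fun x => (modulus (f x : K) `^ q%:num * W x)%:E).
Proof.
move=> mf; apply/measurable_EFinP; apply: measurable_funM.
  apply: (measurableT_comp (measurable_powR _)).
  exact: scalar_measurable_modulus.
exact: measurable_wfun.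
Qed.

Lemma Lq_integrand_ge0 f x : dom W x ->
  (0 <= (modulus (f x : K) `^ q%:num * W x)%:E)%E.
Proof. by move=> Ix; rewrite lee_fin mulr_ge0 ?powR_ge0 ?wfun_ge0. Qed.

Lemma Lq_integral0 : Lq_integral W q (0 : R -> K^o) = 0%E.
Proof.
rewrite unlock integral0_eq// => x _.
have -> : modulus ((0 : R -> K^o) x : K) = 0 by exact: modulus0.
by rewrite powR0 ?mul0r// gt_eqF.
Qed.

Lemma scalar_measurable0 D : scalar_measurable D (0 : R -> K^o).
Proof.
split.
- rewrite (_ : (fun _ => _) = cst 0); first exact: measurable_cst.
  by apply/funext => x; exact: re_part0.
- rewrite (_ : (fun _ => _) = cst 0); first exact: measurable_cst.
  by apply/funext => x; exact: im_part0.
Qed.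

Lemma scalar_measurable_lin D c f g : scalar_measurable D f ->
  scalar_measurable D g -> scalar_measurable D (c *: f + g).
Proof.
move=> [mfr mfi] [mgr mgi]; split.
  rewrite (_ : (fun _ => _) = (fun x => re_part c * re_part (f x : K) -
    im_part c * im_part (f x : K) + re_part (g x : K))); last first.
    by apply/funext => x; rewrite -re_partM -re_partD.
  by apply: measurable_funD => //; apply: measurable_funB;
    exact: measurable_funM.
rewrite (_ : (fun _ => _) = (fun x => re_part c * im_part (f x : K) +
  im_part c * re_part (f x : K) + im_part (g x : K))); last first.
  by apply/funext => x; rewrite -im_partM -im_partD.
by apply: measurable_funD => //; apply: measurable_funD;
  exact: measurable_funM.
Qed.

Lemma Lq_integral_lin c f g : scalar_measurable (dom W) f ->
  scalar_measurable (dom W) g ->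
  (Lq_integral W q (c *: f + g)%R <=
   (2 `^ q%:num * modulus c `^ q%:num)%:E * Lq_integral W q f +
   (2 `^ q%:num)%:E * Lq_integral W q g)%E.
Proof.
move=> mf mg; have mfg := scalar_measurable_lin c mf mg.
have mF := measurable_Lq_integrand mf.
have mG := measurable_Lq_integrand mg.
have q0 : 0 <= q%:num by [].
pose A : R := 2 `^ q%:num * modulus c `^ q%:num.
pose B : R := 2 `^ q%:num.
have A0 : (0 <= A%:E)%E by rewrite lee_fin mulr_ge0 ?powR_ge0.
have B0 : (0 <= B%:E)%E by rewrite lee_fin powR_ge0.
rewrite -/B -/A [Lq_integral]unlock.
rewrite -ge0_integralZl//; last exact: Lq_integrand_ge0.
  2: exact: measurable_dom.
rewrite -ge0_integralZl//; last exact: Lq_integrand_ge0.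
  2: exact: measurable_dom.
have mI := measurable_dom W.
rewrite -ge0_integralD//; last 4 first.
- by move=> x Ix; rewrite mule_ge0// Lq_integrand_ge0.
- by apply: emeasurable_funM => //; exact: measurable_cst.
- by move=> x Ix; rewrite mule_ge0// Lq_integrand_ge0.
- by apply: emeasurable_funM => //; exact: measurable_cst.
apply: ge0_le_integral => //.
- exact: Lq_integrand_ge0.
- exact: measurable_Lq_integrand.
- by apply: emeasurable_funD; apply: emeasurable_funM => //;
    exact: measurable_cst.
- move=> x Ix; rewrite -!EFinM -EFinD lee_fin !mulrA -mulrDl.
  apply: ler_wpM2r; first exact: wfun_ge0.
  set s := modulus (f x : K); set t := modulus (g x : K).
  have h : modulus ((c *: f + g) x : K) <= 2 * Num.max (modulus c * s) t.
    apply: (le_trans (ler_modulusD _ _)); rewrite modulusM -/s -/t.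
    by rewrite mulr_natl mulr2n lerD// le_max lexx ?orbT.
  apply: (@le_trans _ _ ((2 * Num.max (modulus c * s) t) `^ q%:num)).
    by apply: ge0_ler_powR => //; rewrite nnegrE ?modulus_ge0//
      (le_trans _ h)// modulus_ge0.
  rewrite powRM//; last first.
    by rewrite le_max mulr_ge0 ?modulus_ge0.
  have -> : A * s `^ q%:num = B * (modulus c * s) `^ q%:num.
    by rewrite powRM ?modulus_ge0// mulrA.
  rewrite -mulrDr.
  apply: ler_wpM2l; first exact: powR_ge0.
  by case: (leP (modulus c * s) t) => _; rewrite ?lerDl ?lerDr powR_ge0.
Qed.

Lemma Lq_submod_closed : submod_closed Lq_pred.
Proof.
split=> [|c f g].
  apply/mem_set; split; first exact: scalar_measurable0.
  by rewrite Lq_integral0 ltry.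
move=> /set_mem[mf fi] /set_mem[mg gi]; apply/mem_set.
split; first exact: scalar_measurable_lin.
apply: (le_lt_trans (Lq_integral_lin c mf mg)).
by apply: lte_add_pinfty; apply: lte_mul_pinfty;
  rewrite ?lee_fin ?mulr_ge0 ?powR_ge0.
Qed.

HB.instance Definition _ :=
  GRing.isSubmodClosed.Build K (R -> K^o) Lq_pred Lq_submod_closed.

Record Lqfun := LqFun { Lqfun_val :> R -> K^o ; _ : Lqfun_val \in Lq_pred }.

HB.instance Definition _ := [isSub for Lqfun_val].
HB.instance Definition _ := [Choice of Lqfun by <:].
HB.instance Definition _ := [SubChoice_isSubLmodule of Lqfun by <:].

Definition ae_dom_eq (f g : Lqfun) : bool :=
  `[< (f : R -> K^o) = g %[ae (wmeasure W)] >].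

Lemma ae_dom_eqP (f g : Lqfun) :
  reflect ((f : R -> K^o) = g %[ae (wmeasure W)]) (ae_dom_eq f g).
Proof. exact: asboolP. Qed.

Let ae_refl : reflexive ae_dom_eq.
Proof. by move=> f; apply/ae_dom_eqP; exact: aeW. Qed.

Let ae_sym : symmetric ae_dom_eq.
Proof.
by move=> f g; apply/ae_dom_eqP/ae_dom_eqP; apply: filterS => x h I;
  rewrite h.
Qed.

Let ae_trans : transitive ae_dom_eq.
Proof.
move=> g f h /ae_dom_eqP fg /ae_dom_eqP gh; apply/ae_dom_eqP.
by move: fg gh; apply: filterS2 => x fg gh I; rewrite fg// gh.
Qed.

Canonical ae_dom_eq_equiv := EquivRel ae_dom_eq ae_refl ae_sym ae_trans.

Local Open Scope quotient_scope.

Definition Lq : Type := {eq_quot ae_dom_eq}.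
HB.instance Definition _ := Choice.on Lq.
HB.instance Definition _ := EqQuotient.on Lq.

Definition Lq_zero : Lq := lift_cst Lq 0.
Definition Lq_opp := lift_op1 Lq -%R.
Definition Lq_add := lift_op2 Lq +%R.
Definition Lq_scale (c : K) := lift_op1 Lq ( *:%R c).

Lemma Lq_eqP (f g : Lqfun) :
  (f : R -> K^o) = g %[ae (wmeasure W)] -> \pi_Lq f = \pi_Lq g.
Proof. by move=> fg; apply/eqmodP/ae_dom_eqP. Qed.

Lemma Lq_reprP (f : Lqfun) :
  (f : R -> K^o) = (repr (\pi_Lq f)) %[ae (wmeasure W)].
Proof. by apply/ae_dom_eqP; rewrite -eqmodE reprK. Qed.

Canonical pi_Lq_zero := PiConst Lq_zero.

Lemma pi_Lq_oppE : {morph \pi : f / - f >-> Lq_opp f}.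
Proof.
move=> f; unlock Lq_opp; apply: Lq_eqP.
by apply: filterS (Lq_reprP f) => x h I /=; rewrite !fctE h.
Qed.
Canonical pi_Lq_opp := PiMorph1 pi_Lq_oppE.

Lemma pi_Lq_addE : {morph \pi : f g / f + g >-> Lq_add f g}.
Proof.
move=> f g; unlock Lq_add; apply: Lq_eqP.
by apply: filterS2 (Lq_reprP f) (Lq_reprP g) => x h h' I /=;
  rewrite !fctE h// h'.
Qed.
Canonical pi_Lq_add := PiMorph2 pi_Lq_addE.

Lemma pi_Lq_scaleE c : {morph \pi : f / c *: f >-> Lq_scale c f}.
Proof.
move=> f; unlock Lq_scale; apply: Lq_eqP.
by apply: filterS (Lq_reprP f) => x h I /=; rewrite !fctE h.
Qed.
Canonical pi_Lq_scale c := PiMorph1 (pi_Lq_scaleE c).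

Let LqDA : associative Lq_add.
Proof. by move=> x y z; rewrite -[x]reprK -[y]reprK -[z]reprK !piE addrA. Qed.

Let LqDC : commutative Lq_add.
Proof. by move=> x y; rewrite -[x]reprK -[y]reprK !piE addrC. Qed.

Let Lq0D : left_id Lq_zero Lq_add.
Proof. by move=> x; rewrite -[x]reprK !piE add0r. Qed.

Let LqND : left_inverse Lq_zero Lq_opp Lq_add.
Proof. by move=> x; rewrite -[x]reprK !piE addNr. Qed.

HB.instance Definition _ := GRing.isZmodule.Build Lq LqDA LqDC Lq0D LqND.

Let LqZA c d x : Lq_scale c (Lq_scale d x) = Lq_scale (c * d) x.
Proof. by rewrite -[x]reprK !piE scalerA. Qed.

Let Lq1Z : left_id 1 Lq_scale.
Proof. by move=> x; rewrite -[x]reprK !piE scale1r. Qed.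

Let LqZD : right_distributive Lq_scale +%R.
Proof.
move=> c x y; rewrite -[x]reprK -[y]reprK.
by rewrite /GRing.add /= !piE scalerDr.
Qed.

Let LqDZ x : {morph Lq_scale^~ x : c d / c + d >-> c + d}.
Proof.
by move=> c d; rewrite -[x]reprK /GRing.add /= !piE scalerDl.
Qed.

HB.instance Definition _ :=
  GRing.Zmodule_isLmodule.Build K Lq LqZA Lq1Z LqZD LqDZ.

Definition Lq_norm (h : Lq) : R := fine (Lq_integral W q (repr h)) `^ q%:num^-1.

Definition theta : R := Num.min 1 q%:num.

Definition Lq_dist (h1 h2 : Lq) : R := Lq_norm (h1 - h2) `^ theta.

(* The metric topology of [Lq_dist] is introduced through its open sets, so that
   no triangle inequality is needed to build the structure. *)
Definition Lq_open (U : set Lq) : Prop :=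
  forall h, U h -> exists2 e : R, 0 < e & [set h' | Lq_dist h h' < e] `<=` U.

Let Lq_openT : Lq_open setT.
Proof. by move=> h _; exists 1. Qed.

Let Lq_openI : setI_closed Lq_open.
Proof.
move=> U V oU oV h [/oU[e e0 eU] /oV[e' e'0 e'V]].
exists (Num.min e e'); first by rewrite lt_min e0.
by move=> h' /=; rewrite lt_min => /andP[/eU Uh' /e'V].
Qed.

Let Lq_open_bigU (J : Type) (U : J -> set Lq) :
  (forall j, Lq_open (U j)) -> Lq_open (\bigcup_j U j).
Proof.
move=> oU h [j _ /oU[e e0 eU]].
by exists e => // h' /eU Uh'; exists j.
Qed.

HB.instance Definition _ :=
  isOpenTopological.Build Lq Lq_openT Lq_openI Lq_open_bigU.

Lemma is_Lq_restrict (A : set R) (f : Lqfun) : measurable A ->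
  (f : R -> K^o) \_ A \in Lq_pred.
Proof.
move=> mA; have [[mr mi] fi] := set_mem (valP f : _ \in [set f | is_Lq f]).
have mfA : scalar_measurable (dom W) ((f : R -> K^o) \_ A).
  have mI := measurable_dom W.
  split.
    have -> : (fun x => re_part (((f : R -> K^o) \_ A) x : K)) =
        (fun x => re_part (f x : K)) \_ A.
      by apply/funext => x; rewrite !patchE; case: ifP => // _;
        exact: re_part0.
    apply/(measurable_restrict _ mA mI); exact: measurable_funS mI (@subIsetl _ _ _) mr.
  have -> : (fun x => im_part (((f : R -> K^o) \_ A) x : K)) =
      (fun x => im_part (f x : K)) \_ A.
    by apply/funext => x; rewrite !patchE; case: ifP => // _; exact: im_part0.
  by apply/(measurable_restrict _ mA mI); exact: measurable_funS mI (@subIsetl _ _ _) mi.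
apply/mem_set; split; first exact: mfA.
apply: le_lt_trans fi; rewrite unlock.
apply: ge0_le_integral.
- exact: measurable_dom.
- exact: Lq_integrand_ge0.
- exact: measurable_Lq_integrand.
- exact: measurable_Lq_integrand.
move=> x Ix; rewrite lee_fin; apply: ler_wpM2r; first exact: wfun_ge0.
rewrite patchE; case: ifP => // _.
by rewrite modulus0 powR0 ?powR_ge0// gt_eqF.
Qed.

(* Another representative of [h] gives the same class. *)
Definition chi (A : set R) (mA : measurable A) (h : Lq) : Lq :=
  \pi_Lq (LqFun (is_Lq_restrict (repr h) mA)).

End Lq_functions.

Section dimension.
Context (K : fieldType) (V : lmodType K).
Implicit Types A U : set V.

Definition lin_span A : set V :=
  [set v | exists n (c : 'I_n -> K) (e : 'I_n -> V),
     (forall i, A (e i)) /\ v = \sum_(i < n) c i *: e i].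

Definition lin_indep n (e : 'I_n -> V) : Prop :=
  forall c : 'I_n -> K, \sum_(i < n) c i *: e i = 0 -> forall i, c i = 0.

Definition is_dim U (n : nat) : Prop :=
  exists e : 'I_n -> V, lin_indep e /\ lin_span (range e) = U.

Definition finite_dim U : Prop := exists n, is_dim U n.

(* Meaningful for finite-dimensional [U] only. *)
Definition ldim U : nat := xget 0%N [set n | is_dim U n].

End dimension.

Section bilinear_maps.
Context (R : realType) (k : scalars) (W : interval_weight R) (q : {posnum R}).
Local Notation K := (scalar R k).
Local Notation Y := (Lq k W q).
Context (E1 E2 : normedModType K).
Implicit Types T F G : E1 -> E2 -> Y.

Local Open Scope ereal_scope.

Definition ball_image T : set Y :=
  [set T x1 x2 |
    x1 in [set x | (`|x| <= 1)%R] & x2 in [set x | (`|x| <= 1)%R]].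

Definition opnorm T : \bar R :=
  ereal_sup [set (Lq_norm h)%:E | h in ball_image T].

Definition bounded_bilinear T : Prop :=
  bilinear_for *:%R *:%R T /\ opnorm T < +oo.

Definition compact_map T : Prop := precompact (ball_image T).

Definition map_span F : set Y :=
  lin_span [set F x1 x2 | x1 in setT & x2 in setT].

Definition finite_rank : set (E1 -> E2 -> Y) :=
  [set F | bounded_bilinear F /\ finite_dim (map_span F)].

Definition rank F : nat := ldim (map_span F).

Definition map_sub T F : E1 -> E2 -> Y := fun x1 x2 => (T x1 x2 - F x1 x2)%R.

Definition op_closure (S : set (E1 -> E2 -> Y)) : set (E1 -> E2 -> Y) :=
  [set T | bounded_bilinear T /\
     forall e : R, (0 < e)%R -> exists2 F, S F & opnorm (map_sub T F) < e%:E].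

Definition dist_fr T : \bar R :=
  ereal_inf [set opnorm (map_sub T F) | F in finite_rank].

Definition dist_fr_theta T : \bar R :=
  ereal_inf [set opnorm (map_sub T F) `^ theta q | F in finite_rank].

Definition approx_number (n : nat) T : \bar R :=
  ereal_inf [set opnorm (map_sub T F) |
    F in [set F | finite_rank F /\ (rank F < n)%N]].

Definition approx_number_theta (n : nat) T : \bar R :=
  ereal_inf [set opnorm (map_sub T F) `^ theta q |
    F in [set F | finite_rank F /\ (rank F < n)%N]].

Definition inner_pair (p : R * R) : Prop :=
  [/\ lep W < p.1%:E, (p.1 < p.2)%R & p.2%:E < rep W].

Definition inner_restr (c d : R) T : E1 -> E2 -> Y :=
  fun x1 x2 => chi (measurable_open_ival c%:E d%:E) (T x1 x2).

Definition outer_set (c d : R) : set R :=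
  (open_ival (lep W) c%:E `|` open_ival d%:E (rep W))%classic.

Lemma measurable_outer_set c d : measurable (outer_set c d).
Proof. by apply: measurableU; exact: measurable_open_ival. Qed.

Definition gamma (c d : R) T : \bar R :=
  opnorm (fun x1 x2 => chi (measurable_outer_set c d) (T x1 x2)).

Definition tau T : \bar R :=
  ereal_inf [set gamma p.1 p.2 T | p in inner_pair].

End bilinear_maps.

(* Main.v *)
Require Import Defs.
From mathcomp Require Import ring lra.

(* Splitting [T - F] into [chi_outer T] and [chi_inner T - F] gives [dist_fr T
   <= tau T]; splitting [chi_outer T] into [chi_outer (T - F)] and
   [chi_outer F] gives the converse, because the tails of [F] are uniformly
   small on the unit balls: [F] takes bounded values in a finite-dimensional
   space, where coordinates are controlled by the norm, and the tail of each
   basis vector tends to [0] by dominated convergence. Only an asymptotic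
   triangle inequality is needed, and it holds for all [q > 0] because [|x +
   y|^q <= (1 - t)^-q |x|^q + t^-q |y|^q] for [0 < t < 1]. *)

Set Implicit Arguments.
Unset Strict Implicit.
Unset Printing Implicit Defensive.

Import Order.TTheory GRing.Theory Num.Theory.
Import numFieldNormedType.Exports.

Local Open Scope classical_set_scope.
Local Open Scope ring_scope.
Local Open Scope ereal_scope.

(* The library's hint, which uses [apply:], does not unify the display of
   [lebesgue_measure] with the default one. *)
#[local] Hint Extern 0 (Filter (nbhs (almost_everywhere lebesgue_measure))) =>
  (exact: (ae_filter_ringOfSetsType (@lebesgue_measure _))) : typeclass_instances.

(** * Null sets of [u dx] compared with Lebesgue null sets *)

Section weighted_measure_ae.
Context (R : realType) (W : interval_weight R).

Let Wr : R -> \bar R := fun x => ((W \_ (dom W)) x)%:E.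

Let Wr_ge0 x : 0 <= Wr x.
Proof. by rewrite lee_fin patchE; case: ifPn => // /set_mem; exact: wfun_ge0. Qed.

Let measurable_Wr (A : set R) : measurable_fun A Wr.
Proof.
apply: (measurable_funS measurableT) => //.
apply/measurable_EFinP; apply/(measurable_restrictT _ (measurable_dom W)).
exact: measurable_wfun.
Qed.

Lemma wmeasure_eq0P (A : set R) : measurable A ->
  wmeasure W A = 0 <->
  {ae lebesgue_measure, forall x, A x -> dom W x -> W x = 0%R}.
Proof.
move=> mA.
rewrite /wmeasure -/(Wr _).
have -> : \int[lebesgue_measure]_(x in A) Wr x =
          \int[lebesgue_measure]_(x in A) `|Wr x|.
  by apply: eq_integral => x _; rewrite gee0_abs.
apply: (iff_trans (ae_eq_integral_abs lebesgue_measure mA (@measurable_Wr A))).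
split; apply: filterS => x h Ax.
  by move=> dx; have := h Ax; rewrite /Wr patchE mem_set// => -[].
rewrite /Wr patchE; case: ifPn => // /set_mem dx.
by rewrite (h Ax dx).
Qed.

(** A [u dx]-null set may have positive Lebesgue measure, but the weight then vanishes almost
    everywhere on it; hence the restriction to points with [W x <> 0]. *)
Lemma ae_wmeasure (P : R -> Prop) : {ae wmeasure W, forall x, P x} ->
  {ae lebesgue_measure, forall x, dom W x -> W x <> 0%R -> P x}.
Proof.
move=> [A [mA A0 PA]].
move: A0 => /(wmeasure_eq0P mA); apply: filterS => x h dx Wx.
by apply: contrapT => nP; apply: Wx; apply: h => //; exact: PA.
Qed.

(** The exceptional set may contain an arbitrary part of the zero set of [W], so [B] supplies a
    measurable description of [P] on [dom W]. Points outside [dom W] carry no mass. *)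
Lemma wmeasure_ae (P : R -> Prop) :
  (exists2 B, measurable B & (forall x, dom W x -> (B x <-> P x))) ->
  {ae lebesgue_measure, forall x, dom W x -> W x <> 0%R -> P x} ->
  {ae wmeasure W, forall x, P x}.
Proof.
move=> [B mB BP] aeP.
have mA : measurable (~` dom W `|` (dom W `&` ~` B)).
  by apply: measurableU; [|apply: measurableI]; try apply: measurableC => //;
    exact: measurable_dom.
exists (~` dom W `|` (dom W `&` ~` B)); split => //.
  apply/(wmeasure_eq0P mA); apply: filterS aeP => x h [//|[dx nB] _].
  by apply: contrapT => Wx; apply: nB; apply/(BP _ dx)/h.
move=> x /= nP; have [dx|] := pselect (dom W x); last by left.
by right; split => // /(BP _ dx).
Qed.

End weighted_measure_ae.

(** * The integral of [|f|^q u]: homogeneity, an asymptotic triangle inequality, definiteness and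
    vanishing tails *)

Section Lq_integral_theory.
Context (R : realType) (k : scalars) (W : interval_weight R) (q : {posnum R}).
Local Notation K := (scalar R k).
Local Notation Lqfun := (Lqfun k W q).
Implicit Types f g : R -> K^o.

Lemma Lq_integral_ge0 f : 0 <= Lq_integral W q f.
Proof. by rewrite unlock; apply: integral_ge0 => x; exact: Lq_integrand_ge0. Qed.

Lemma Lqfun_measurable (f : Lqfun) : scalar_measurable (dom W) (f : R -> K^o).
Proof. by have [] := set_mem (valP f : _ \in [set f | is_Lq W q f]). Qed.

Lemma Lqfun_fin_num (f : Lqfun) :
  Lq_integral W q (f : R -> K^o) \is a fin_num.
Proof.
have [_ fi] := set_mem (valP f : _ \in [set f | is_Lq W q f]).
by rewrite ge0_fin_numE// Lq_integral_ge0.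
Qed.

Lemma Lq_integral_ae (f g : Lqfun) :
  (f : R -> K^o) = g %[ae (wmeasure W)] ->
  Lq_integral W q (f : R -> K^o) = Lq_integral W q (g : R -> K^o).
Proof.
move=> /ae_wmeasure fg; rewrite unlock; apply: ge0_ae_eq_integral.
- exact: measurable_dom.
- by apply: measurable_Lq_integrand; exact: Lqfun_measurable.
- by apply: measurable_Lq_integrand; exact: Lqfun_measurable.
- exact: Lq_integrand_ge0.
- exact: Lq_integrand_ge0.
apply: filterS fg => x h dx.
have [->|/eqP Wx] := eqVneq (W x) 0%R; first by rewrite !mulr0.
by rewrite h.
Qed.

Lemma Lq_integralZ (c : K) f : scalar_measurable (dom W) f ->
  Lq_integral W q (c *: f)%R = (modulus c `^ q%:num)%:E * Lq_integral W q f.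
Proof.
move=> mf; rewrite unlock -ge0_integralZl//; first last.
- by rewrite lee_fin powR_ge0.
- exact: Lq_integrand_ge0.
- exact: measurable_Lq_integrand.
- exact: measurable_dom.
apply: eq_integral => x _; rewrite -EFinM mulrA -powRM ?modulus_ge0//.
by rewrite -modulusM.
Qed.

(* With [s] the right-hand side, [|y| <= (1 - t) s] and [|z| <= t s]. *)
Lemma modulusD_max (t : R) (y z : K) : (0 < t < 1)%R ->
  (modulus (y + z) <=
   Num.max ((1 - t)^-1 * modulus y) (t^-1 * modulus z))%R.
Proof.
move=> /andP[t0 t1]; have t1' : (0 < 1 - t)%R by rewrite subr_gt0.
set s := Num.max _ _.
have ys : (modulus y <= (1 - t) * s)%R.
  by rewrite -ler_pdivrMl// le_max lexx.
have zs : (modulus z <= t * s)%R.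
  by rewrite -ler_pdivrMl// le_max lexx orbT.
apply: le_trans (ler_modulusD _ _) _; apply: le_trans (lerD ys zs) _.
by rewrite -mulrDl subrK mul1r.
Qed.

(** Integrating [modulusD_max] and bounding a maximum by a sum. The parameter [t] stays free: as [t]
    tends to 0 the coefficient of the first term tends to 1, at the cost of a large coefficient on
    the second. *)
Lemma Lq_integralD (t : R) f g : (0 < t < 1)%R ->
  scalar_measurable (dom W) f -> scalar_measurable (dom W) g ->
  Lq_integral W q (f + g)%R <=
    ((1 - t)^-1 `^ q%:num)%:E * Lq_integral W q f +
    (t^-1 `^ q%:num)%:E * Lq_integral W q g.
Proof.
move=> t01 mf mg; have mI := measurable_dom W.
have mfg : scalar_measurable (dom W) (f + g)%R.
  by rewrite -[f]scale1r; exact: scalar_measurable_lin.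
have mF := measurable_Lq_integrand q mf.
have mG := measurable_Lq_integrand q mg.
set A := ((1 - t)^-1 `^ q%:num)%R; set B := (t^-1 `^ q%:num)%R.
have A0 : (0 <= A%:E) by rewrite lee_fin powR_ge0.
have B0 : (0 <= B%:E) by rewrite lee_fin powR_ge0.
rewrite [Lq_integral]unlock.
rewrite -ge0_integralZl//; last exact: Lq_integrand_ge0.
rewrite -ge0_integralZl//; last exact: Lq_integrand_ge0.
rewrite -ge0_integralD//; last 4 first.
- by move=> x Ix; rewrite mule_ge0// Lq_integrand_ge0.
- by apply: emeasurable_funM => //; exact: measurable_cst.
- by move=> x Ix; rewrite mule_ge0// Lq_integrand_ge0.
- by apply: emeasurable_funM => //; exact: measurable_cst.
apply: ge0_le_integral => //.
- exact: Lq_integrand_ge0.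
- exact: measurable_Lq_integrand.
- by apply: emeasurable_funD; apply: emeasurable_funM => //;
    exact: measurable_cst.
move=> x Ix; rewrite -!EFinM -EFinD lee_fin !mulrA -mulrDl.
apply: ler_wpM2r; first exact: wfun_ge0.
have h := modulusD_max (f x : K) (g x : K) t01.
have [t0 t1] := andP t01.
have t1' : (0 <= (1 - t)^-1)%R by rewrite invr_ge0 subr_ge0 ltW.
have t0' : (0 <= t^-1)%R by rewrite invr_ge0 ltW.
apply: (@le_trans _ _ (Num.max ((1 - t)^-1 * modulus (f x : K))
    (t^-1 * modulus (g x : K)) `^ q%:num)%R).
  by apply: ge0_ler_powR => //; rewrite nnegrE ?modulus_ge0//
    (le_trans _ h)// modulus_ge0.
rewrite /A /B -!powRM ?modulus_ge0//.
by case: (leP (_ * modulus (f x : K))%R _) => _; rewrite ?lerDl ?lerDr powR_ge0.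
Qed.

(** The nonnegative integrand vanishes Lebesgue-almost everywhere, so [f] vanishes where the weight
    does not; measurability of its zero set turns this into a statement about [u dx]. *)
Lemma Lq_integral_eq0 (f : Lqfun) : Lq_integral W q (f : R -> K^o) = 0 ->
  (f : R -> K^o) = (0%R : Lqfun) %[ae (wmeasure W)].
Proof.
have mf := Lqfun_measurable f; have mI := measurable_dom W => f0.
pose g (x : R) := (modulus (f x : K) `^ q%:num * W x)%:E.
have mg : measurable_fun (dom W) g by exact: measurable_Lq_integrand.
have g0 : \int[lebesgue_measure]_(x in dom W) `|g x| = 0.
  rewrite -[RHS]f0 unlock; apply: eq_integral => x /set_mem Ix.
  by rewrite gee0_abs//; exact: Lq_integrand_ge0.
have modulus_eq0 (z : K) : modulus z = 0%R -> z = 0%R.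
  rewrite modulusE => /eqP; rewrite sqrtr_eq0 => z0.
  have : (re_part z ^+ 2 + im_part z ^+ 2 == 0)%R.
    by rewrite eq_le z0 addr_ge0// sqr_ge0.
  case: k z {z0} => [z|[a b]] /=; first by rewrite expr0n addr0 sqrf_eq0 => /eqP.
  rewrite paddr_eq0 ?sqr_ge0// !sqrf_eq0 => /andP[/eqP -> /eqP ->//].
apply: wmeasure_ae.
  exists (dom W `&` (fun x => modulus (f x : K)) @^-1` [set 0%R]).
    exact: (scalar_measurable_modulus mf).
  move=> x dx; split => [[_ /modulus_eq0] //|h]; split => //=.
  by rewrite h// modulus0.
move/(ae_eq_integral_abs lebesgue_measure mI mg): g0; apply: filterS => x h dx Wx _.
have /= [/eqP] := h dx; rewrite mulf_eq0 => /orP[|/eqP//].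
by rewrite powR_eq0 => /andP[/eqP/modulus_eq0].
Qed.

(** Dominated convergence: each point eventually leaves the sets [A n], and the integrand of [f]
    itself is the majorant. *)
Lemma cvg_Lq_integral_restrict (A : (set R)^nat) (f : Lqfun) :
  (forall n, measurable (A n)) ->
  (forall x, dom W x -> \forall n \near \oo, ~ A n x) ->
  Lq_integral W q ((f : R -> K^o) \_ (A n)) @[n --> \oo] --> 0.
Proof.
move=> mA A0; have mI := measurable_dom W.
have mf := Lqfun_measurable f.
pose g (x : R) := (modulus (f x : K) `^ q%:num * W x)%:E.
pose gA n (x : R) :=
  (modulus (((f : R -> K^o) \_ (A n)) x : K) `^ q%:num * W x)%:E.
have -> : (fun n => Lq_integral W q ((f : R -> K^o) \_ (A n))) =
    (fun n => \int[lebesgue_measure]_(x in dom W) gA n x).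
  by apply/funext => n; rewrite unlock.
have mgA n : measurable_fun (dom W) (gA n).
  by apply: measurable_Lq_integrand; exact: (Lqfun_measurable (LqFun (is_Lq_restrict f (mA n)))).
have ig : lebesgue_measure.-integrable (dom W) g.
  apply/integrableP; split; first exact: measurable_Lq_integrand.
  have := Lqfun_fin_num f; rewrite ge0_fin_numE ?Lq_integral_ge0// unlock.
  apply: le_lt_trans; rewrite le_eqVlt; apply/orP; left; apply/eqP.
  apply: eq_integral => x /set_mem Ix.
  by rewrite gee0_abs//; exact: Lq_integrand_ge0.
have := @dominated_cvg _ _ R lebesgue_measure (dom W) mI gA (cst 0) g mgA.
rewrite integral0; apply => //.
  move=> x dx; apply: cvg_near_cst; near=> n.
  rewrite /gA patchE memNset; last by near: n; exact: A0.
  by rewrite modulus0 powR0 ?mul0r// gt_eqF.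
move=> n x dx; rewrite gee0_abs; last exact: Lq_integrand_ge0.
rewrite lee_fin; apply: ler_wpM2r; first exact: wfun_ge0.
rewrite patchE; case: ifP => // _.
by rewrite modulus0 powR0 ?powR_ge0// gt_eqF.
Unshelve. all: by end_near. Qed.

End Lq_integral_theory.

(** * The quasi-norm and the cut-off operators on equivalence classes *)

Section Lq_norm_theory.
Context (R : realType) (k : scalars) (W : interval_weight R) (q : {posnum R}).
Local Notation K := (scalar R k).
Local Notation Lqfun := (Lqfun k W q).
Local Notation Y := (Lq k W q).
Implicit Types (f g : Lqfun) (h : Y).
Local Open Scope quotient_scope.
Local Open Scope ring_scope.

Lemma pi_LqD f g : \pi_Y (f + g) = \pi_Y f + \pi_Y g.
Proof. by rewrite [RHS]/GRing.add /= !piE. Qed.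

Lemma pi_LqZ (c : K) f : \pi_Y (c *: f) = c *: \pi_Y f.
Proof. by rewrite [RHS]/GRing.scale /= !piE. Qed.

Lemma pi_Lq0 : \pi_Y (0 : Lqfun) = 0.
Proof. by rewrite [RHS]/GRing.zero /= !piE. Qed.

Lemma Lq_norm_pi f :
  Lq_norm (\pi_Y f) = fine (Lq_integral W q (f : R -> K^o)) `^ q%:num^-1.
Proof. by rewrite /Lq_norm (Lq_integral_ae (Lq_reprP f)). Qed.

Lemma Lq_norm_ge0 h : 0 <= Lq_norm h.
Proof. exact: powR_ge0. Qed.

Lemma Lq_norm_powR f :
  (Lq_norm (\pi_Y f) `^ q%:num)%:E = Lq_integral W q (f : R -> K^o).
Proof.
rewrite Lq_norm_pi -powRrM mulVf// powRr1 ?fineK ?Lqfun_fin_num//.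
by rewrite fine_ge0// Lq_integral_ge0.
Qed.

(** Keeping the [q]-th powers makes one inequality serve both [q < 1] and [q >= 1]. *)
Lemma Lq_norm_powRD (t : R) (h1 h2 : Y) : 0 < t < 1 ->
  Lq_norm (h1 + h2) `^ q%:num <=
    ((1 - t)^-1 * Lq_norm h1) `^ q%:num + (t^-1 * Lq_norm h2) `^ q%:num.
Proof.
move=> /[dup] t01 /andP[t0 t1].
have t0' : 0 <= t^-1 by rewrite invr_ge0 ltW.
have t1' : 0 <= (1 - t)^-1 by rewrite invr_ge0 subr_ge0 ltW.
rewrite !powRM ?Lq_norm_ge0//.
rewrite -[h1]reprK -[h2]reprK -pi_LqD.
have := Lq_integralD q t01 (Lqfun_measurable (repr h1)) (Lqfun_measurable (repr h2)).
by rewrite -(Lq_norm_powR (_ + _)) -!Lq_norm_powR -!EFinM -EFinD lee_fin.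
Qed.

Lemma Lq_normZ (c : K) h : Lq_norm (c *: h) = modulus c * Lq_norm h.
Proof.
rewrite -[h]reprK -pi_LqZ !Lq_norm_pi Lq_integralZ ?fineM//; last 2 first.
- exact: Lqfun_fin_num.
- exact: Lqfun_measurable.
rewrite powRM ?powR_ge0 ?fine_ge0 ?Lq_integral_ge0//=.
by rewrite -powRrM mulfV// powRr1// modulus_ge0.
Qed.

Lemma Lq_norm0_eq0 h : Lq_norm h = 0 -> h = 0.
Proof.
rewrite -[h]reprK => h0; rewrite -pi_Lq0; apply: Lq_eqP.
by apply: Lq_integral_eq0; rewrite -Lq_norm_powR h0 powR0// gt_eqF.
Qed.

(** Two representatives that agree almost everywhere have restrictions that agree there too, so
    [chi] can be computed on any representative. *)
Lemma chi_pi (A : set R) (mA : measurable A) f :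
  chi mA (\pi_Y f) = \pi_Y (LqFun (is_Lq_restrict f mA)).
Proof.
rewrite /chi; apply: Lq_eqP; apply: filterS (Lq_reprP f) => x fx _ /=.
by rewrite !patchE; case: ifP => // _; rewrite -fx.
Qed.

Lemma chiD (A : set R) (mA : measurable A) (h1 h2 : Y) :
  chi mA (h1 + h2) = chi mA h1 + chi mA h2.
Proof.
rewrite -[h1]reprK -[h2]reprK -pi_LqD !chi_pi -pi_LqD.
apply: Lq_eqP; apply: aeW => x _ /=.
by rewrite /GRing.add /= !patchE; case: ifP => // _; rewrite addr0.
Qed.

Lemma chiZ (A : set R) (mA : measurable A) (c : K) h :
  chi mA (c *: h) = c *: chi mA h.
Proof.
rewrite -[h]reprK -pi_LqZ !chi_pi -pi_LqZ.
apply: Lq_eqP; apply: aeW => x _ /=.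
rewrite /GRing.scale /= !patchE; case: ifP => // _.
exact: esym (scaler0 (GRing.regular K) c).
Qed.

Lemma chi_sum (A : set R) (mA : measurable A) n (h : 'I_n -> Y) :
  chi mA (\sum_i h i) = \sum_i chi mA (h i).
Proof.
apply: (big_morph (chi mA) (chiD mA)).
by have := chiZ mA 0 0; rewrite !scale0r.
Qed.

Lemma Lq_norm_chi_le (A : set R) (mA : measurable A) h :
  Lq_norm (chi mA h) <= Lq_norm h.
Proof.
rewrite -[h]reprK chi_pi !Lq_norm_pi.
have I0 := Lq_integral_ge0 W q.
apply: ge0_ler_powR; rewrite ?invr_ge0 ?nnegrE ?fine_ge0//.
apply: fine_le; rewrite ?(Lqfun_fin_num (LqFun (is_Lq_restrict _ mA))) ?Lqfun_fin_num//=.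
rewrite unlock; apply: ge0_le_integral.
- exact: measurable_dom.
- exact: Lq_integrand_ge0.
- apply: measurable_Lq_integrand.
  exact: (Lqfun_measurable (LqFun (is_Lq_restrict _ mA))).
- by apply: measurable_Lq_integrand; exact: Lqfun_measurable.
move=> x Ix; rewrite lee_fin; apply: ler_wpM2r; first exact: wfun_ge0.
rewrite patchE; case: ifP => // _.
by rewrite modulus0 powR0 ?powR_ge0// gt_eqF.
Qed.

Lemma cvg_Lq_norm_chi (A : (set R)^nat) (mA : forall n, measurable (A n)) h :
  (forall x, dom W x -> \forall n \near \oo, ~ A n x) ->
  Lq_norm (chi (mA n) h) @[n --> \oo] --> 0.
Proof.
move=> A0; rewrite -[h]reprK; set f := repr h.
have := @cvg_Lq_integral_restrict R k W q A f mA A0.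
move/fine_cvg; set I := (I in I @ _ --> _) => I0.
have -> : (fun n => Lq_norm (chi (mA n) (\pi_Y f))) =
    (fun n => I n `^ q%:num^-1).
  by apply/funext => n; rewrite chi_pi Lq_norm_pi.
rewrite -(@powR0 _ q%:num^-1) ?invr_neq0//.
(* Continuity of the [q]-th root at 0: a tolerance [e] for the norms is the tolerance [e ^ q] for
   the integrals. *)
apply/cvgrPdist_le => e e0.
move/cvgrPdist_le : I0 => /(_ (e `^ q%:num)).
rewrite powR_gt0// => /(_ isT); apply: filterS => n /=.
have In : 0 <= I n by rewrite fine_ge0// Lq_integral_ge0.
rewrite !sub0r powR0 ?invr_neq0// sub0r !normrN !ger0_norm ?powR_ge0// => Ie.
rewrite -[leRHS]powRr1 ?(ltW e0)// -(@mulfV _ q%:num)// powRrM.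
by apply: ge0_ler_powR; rewrite ?invr_ge0 ?nnegrE ?powR_ge0.
Qed.

Lemma chi_inner_outer (c d : R) h :
  chi (measurable_open_ival c%:E d%:E) h +
  chi (measurable_outer_set W c d) h = h.
Proof.
Abort.

End Lq_norm_theory.

(** * Splitting and exhausting the interval *)

Section exhaustion.
Context (R : realType) (k : scalars) (W : interval_weight R) (q : {posnum R}).
Local Open Scope quotient_scope.
Local Open Scope ring_scope.

(** Inside [dom W] the two sets are disjoint and miss only the points [c] and [d], which form a
    Lebesgue null set and hence a [u dx]-null set. *)
Lemma chi_inner_outer (c d : R) (h : Lq k W q) : c < d ->
  chi (measurable_open_ival c%:E d%:E) h +
  chi (measurable_outer_set W c d) h = h.
Proof.
move=> cd; rewrite -[h]reprK !chi_pi -pi_LqD; apply: Lq_eqP.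
have mcd : measurable [set c; d].
  exact: (measurableU _ _ (measurable_set1 c) (measurable_set1 d)).
have mN : measurable (~` dom W `|` [set c; d]).
  by apply: measurableU => //; apply: measurableC; exact: measurable_dom.
exists (~` dom W `|` [set c; d]); split => //.
  apply/(wmeasure_eq0P _ mN); exists [set c; d]; split => //.
    by apply: countable_lebesgue_measure0; exact: finite_set_countable.
  by move=> x /= /not_implyP[Nx /not_implyP[dx _]]; case: Nx.
move=> x /= nP; apply: contrapT => /not_orP[/contrapT dx] /not_orP[xc xd].
apply: nP => _; rewrite /GRing.add /= !patchE.
have [ax xb] := dx.
have ival_c : x \in open_ival (c%:E) d%:E = (c < x < d).
  by apply/idP/idP => [/set_mem[]|/andP[cx xd']]; rewrite ?lte_fin;
    [move=> -> ->|apply/mem_set; split; rewrite lte_fin].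
have outer : x \in outer_set W c d = (x < c) || (d < x).
  apply/idP/idP => [/set_mem[[_]|[+ _]]|]; rewrite ?lte_fin.
  - by move=> ->.
  - by move=> ->; rewrite orbT.
  - by case/orP => ?; apply/mem_set; [left|right]; split; rewrite ?lte_fin.
rewrite ival_c outer.
have [xc'|xc'|//] := ltgtP x c.
  rewrite /= [X in X + _](_ : _ = 0)//; exact: add0r.
have [xd'|xd'|//] := ltgtP x d.
  exact: addr0.
exact: add0r.
Qed.

(** Supplies left endpoints that approach [a], finite or not, while staying below [x0]. For finite
    [a] the factor 1/2 keeps the term of index 0 strictly below [x0]. *)
Lemma cofinal_left (a : \bar R) (x0 : R) : (a < x0%:E)%E ->
  exists2 u : R^nat, (forall n, (a < (u n)%:E)%E /\ u n < x0) &
    forall x, (a < x%:E)%E -> \forall n \near \oo, u n <= x.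
Proof.
case: a => [r|//|]; rewrite ?lte_fin.
  move=> rx0; exists (fun n => r + (x0 - r) / 2 * n.+1%:R^-1).
    move=> n; rewrite lte_fin ltrDl; split.
      by rewrite !mulr_gt0 ?subr_gt0 ?invr_gt0.
    have n1 : n.+1%:R^-1 <= 1 :> R by rewrite invf_le1// ler1n.
    have : (x0 - r) / 2 * n.+1%:R^-1 <= (x0 - r) / 2 * 1.
      by apply: ler_wpM2l => //; rewrite divr_ge0// subr_ge0 ltW.
    by rewrite mulr1; move: (_ * n.+1%:R^-1) => z ?; lra.
  move=> x; rewrite lte_fin => rx.
  have e0 : 0 < (x - r) / ((x0 - r) / 2) by rewrite !divr_gt0 ?subr_gt0.
  near=> n; rewrite -lerBrDl mulrC -ler_pdivlMr ?divr_gt0 ?subr_gt0//.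
  by apply: ltW; near: n; exact: (near_infty_natSinv_lt (PosNum e0)).
move=> _; exists (fun n => x0 - n.+1%:R).
  by move=> n; split; [exact: ltNyr|rewrite ltrBlDr ltrDl].
move=> x _; near=> n; rewrite lerBlDr addrC -lerBlDr.
apply: (@le_trans _ _ n%:R); last by rewrite ler_nat.
by near: n; exact: nbhs_infty_ger.
Unshelve. all: by end_near. Qed.

Lemma cofinal_right (b : \bar R) (x0 : R) : (x0%:E < b)%E ->
  exists2 u : R^nat, (forall n, ((u n)%:E < b)%E /\ x0 < u n) &
    forall x, (x%:E < b)%E -> \forall n \near \oo, x <= u n.
Proof.
rewrite -lteN2 => /cofinal_left[u u1 u2]; exists (fun n => - u n).
  by move=> n; have [? ?] := u1 n; split; [rewrite EFinN lteNl|rewrite ltrNr].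
move=> x; rewrite -lteN2 => /u2; apply: filterS => n.
by rewrite lerNr.
Qed.

Lemma dom_nonempty : exists x, dom W x.
Proof.
have := lep_lt_rep W; rewrite /dom /open_ival.
case: (lep W) => [r|//|]; case: (rep W) => [s| |//] //=.
- by rewrite lte_fin => rs; exists ((r + s) / 2); split; rewrite lte_fin; lra.
- by move=> _; exists (r + 1); split; rewrite ?ltry// lte_fin; lra.
- by move=> _; exists (s - 1); split; rewrite ?ltNyr// lte_fin; lra.
- by move=> _; exists 0; split; rewrite ?ltNyr ?ltry.
Qed.

(** Endpoints are taken on both sides of a fixed point of [dom W]. Every [x] eventually lies in the
    closed interval from [c n] to [d n], which is disjoint from the outer set because that set is
    defined by strict inequalities. *)
Lemma dom_exhaustion : exists c d : R^nat,
  (forall n, inner_pair W (c n, d n)) /\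
  forall x, dom W x -> \forall n \near \oo, ~ outer_set W (c n) (d n) x.
Proof.
have [x0 [/cofinal_left[c c1 c2] /cofinal_right[d d1 d2]]] := dom_nonempty.
exists c, d; split => [n|x [/c2 cx /d2 xd]].
  by have [? ?] := c1 n; have [? ?] := d1 n; split => //=; lra.
apply: filterS2 cx xd => n cx xd [] [] /=; rewrite lte_fin.
  by move=> _; rewrite ltNge cx.
by rewrite ltNge xd.
Qed.

End exhaustion.

(** * Real and complex scalars: parts, modulus and completeness *)

Section quasi_norm.
Context (R : realType) (k : scalars).
Local Notation K := (scalar R k).
Local Open Scope ring_scope.

Lemma modulusN (z : K) : modulus (- z) = modulus z.
Proof. by rewrite /modulus normrN. Qed.

Lemma modulus1 : modulus (1 : K) = 1.
Proof. by rewrite /modulus normr1; case: k. Qed.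

Lemma re_partN (z : K) : re_part (- z) = - re_part z.
Proof. by case: k z => [//|[]]. Qed.

Lemma im_partN (z : K) : im_part (- z) = - im_part z.
Proof. by case: k z => [z|[] //]; rewrite oppr0. Qed.

Lemma normr_re_part_le (z : K) : `|re_part z| <= modulus z.
Proof.
by rewrite modulusE -sqrtr_sqr; apply: ler_wsqrtr; rewrite lerDl sqr_ge0.
Qed.

Lemma normr_im_part_le (z : K) : `|im_part z| <= modulus z.
Proof.
by rewrite modulusE -sqrtr_sqr; apply: ler_wsqrtr; rewrite lerDr sqr_ge0.
Qed.

Lemma modulus_le_re_im (z : K) : modulus z <= `|re_part z| + `|im_part z|.
Proof.
rewrite modulusE -(ler_pXn2r (n := 2))// ?nnegrE ?sqrtr_ge0 ?addr_ge0//.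
rewrite sqr_sqrtr ?addr_ge0 ?sqr_ge0// sqrrD !real_normK ?num_real//.
by rewrite -addrA lerD2l lerDr mulrn_wge0// mulr_ge0.
Qed.

Lemma cvg_sum_ord n (f : 'I_n -> R^nat) (l : 'I_n -> R) :
  (forall i, f i m @[m --> \oo] --> l i) ->
  \sum_i f i m @[m --> \oo] --> \sum_i l i.
Proof.
move=> fl; have addc : continuous (fun x : R * R => x.1 + x.2).
  exact: add_continuous.
by apply: (@cvg_big R _ _ 0 xpredT addc nat \oo _ f l) => i _; exact: fl.
Qed.

Lemma scalar_of_parts (a b : R) :
  (k = RealScalars -> b = 0) -> exists z : K, re_part z = a /\ im_part z = b.
Proof.
by case: k => [/(_ erefl) ->|_]; [exists a|exists (Complex a b)].
Qed.

Lemma real_cauchy_cvg (u : R^nat) :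
  (forall e : R, 0 < e -> exists M, forall m l, (M <= m)%N -> (M <= l)%N ->
    `|u m - u l| <= e) -> cvgn u.
Proof.
move=> uC; apply: cauchy_cvg; apply: cauchy_exP => e e0.
have [M uM] := uC (e / 2) (divr_gt0 e0 (ltr0n _ 2)).
exists (u M); exists M => //= m Mm; rewrite -ball_normE /=.
apply: (@le_lt_trans _ _ (e / 2)); first exact: uM.
by rewrite ltr_pdivrMr// ltr_pMr// ltr1n.
Qed.

Lemma scalar_cauchy_cvg (c : nat -> K) :
  (forall e : R, 0 < e -> exists M, forall m l, (M <= m)%N -> (M <= l)%N ->
    modulus (c m - c l) <= e) ->
  exists z : K, modulus (c m - z) @[m --> \oo] --> 0.
Proof.
move=> cC.
have cvg_re : cvgn (fun m => re_part (c m)).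
  apply: real_cauchy_cvg => e /cC[M cM]; exists M => m l Mm Ml.
  by rewrite -re_partN -re_partD (le_trans (normr_re_part_le _))// cM.
have cvg_im : cvgn (fun m => im_part (c m)).
  apply: real_cauchy_cvg => e /cC[M cM]; exists M => m l Mm Ml.
  by rewrite -im_partN -im_partD (le_trans (normr_im_part_le _))// cM.
have [|z [rez imz]] :=
  @scalar_of_parts (limn (fun m => re_part (c m))) (limn (fun m => im_part (c m))).
  (* For real scalars all imaginary parts are 0, hence so is their limit. *)
  move=> kR; rewrite [X in limn X](_ : _ = cst 0) ?lim_cst//.
  by apply/funext => m; case: k kR (c m).
exists z.
apply: (@squeeze_cvgr _ _ _ _ (cst 0)
    (fun m => `|re_part (c m) - re_part z| + `|im_part (c m) - im_part z|)).
- near=> m; rewrite modulus_ge0/= -re_partN -re_partD -im_partN -im_partD.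
  exact: modulus_le_re_im.
- exact: cvg_cst.
rewrite -[X in _ --> X](addr0 0); apply: cvgD.
  rewrite -(normr0 R); apply: cvg_norm; rewrite -(subrr (re_part z)).
  by apply: cvgB; [rewrite rez|exact: cvg_cst].
rewrite -(normr0 R); apply: cvg_norm; rewrite -(subrr (im_part z)).
by apply: cvgB; [rewrite imz|exact: cvg_cst].
Unshelve. all: by end_near. Qed.

(** * Coordinates in finite-dimensional subspaces of an abstract quasi-normed space *)

Context (V : lmodType K) (N : V -> R) (C : R)
  (N_ge0 : forall v, 0 <= N v)
  (N_scale : forall (c : K) v, N (c *: v) = modulus c * N v)
  (N_eq0 : forall v, N v = 0 -> v = 0)
  (C_ge0 : 0 <= C)
  (N_add : forall u v, N (u + v) <= C * (N u + N v)).

(** Each further summand costs another factor [C], so the constant [D] depends on the number of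
    terms. *)
Lemma quasi_norm_sum n : exists2 D : R, 0 <= D &
  forall x : 'I_n -> V, N (\sum_i x i) <= D * \sum_i N (x i).
Proof.
elim: n => [|n [D D0 ND]].
  exists 0 => // x; rewrite !big_ord0 mul0r.
  by rewrite -(scale0r 0) N_scale modulus0 mul0r.
exists (C * (D + 1)); first by rewrite mulr_ge0// addr_ge0.
move=> x; rewrite !big_ord_recr/=; apply: le_trans (N_add _ _) _.
rewrite -mulrA; apply: ler_wpM2l => //.
apply: le_trans (lerD (ND _) (lexx _)) _.
set S := \sum_(i < n) _; have S0 : 0 <= S by apply: sumr_ge0.
have Nx := N_ge0 (x ord_max).
rewrite -subr_ge0 (_ : _ - _ = D * N (x ord_max) + S); last by ring.
by rewrite addr_ge0// mulr_ge0.
Qed.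

(** Induction on [n]: the last vector [v] has positive distance [d] from the span of the others,
    since that span is complete by the induction hypothesis. This [d] controls the last coordinate;
    subtracting its term leaves the others to the induction hypothesis. *)
Lemma lin_indep_coord_bound n (e : 'I_n -> V) : lin_indep e ->
  exists2 M : R, 0 <= M &
    forall (c : 'I_n -> K) i, modulus (c i) <= M * N (\sum_j c j *: e j).
Proof.
elim: n e => [e _|n IH e ie]; first by exists 0 => // c [].
pose e' i := e (widen_ord (leqnSn n) i); pose v := e ord_max.
pose comb (c : 'I_n -> K) := \sum_i c i *: e' i.
have ie' (c : 'I_n -> K) (b : K) : comb c + b *: v = 0 ->
    (forall i, c i = 0) /\ b = 0.
  pose c' (i : 'I_n.+1) := if unlift ord_max i is Some j then c j else b.
  have c'E i : c' (widen_ord (leqnSn n) i) = c i.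
    rewrite /c' (_ : widen_ord _ _ = lift ord_max i) ?liftK//.
    by apply: val_inj => /=; rewrite /bump leqNgt ltn_ord.
  have c'v : c' ord_max = b by rewrite /c' unlift_none.
  move=> s0; have c'0 : forall i, c' i = 0.
    apply: ie; rewrite big_ord_recr /= c'v -[RHS]s0; congr (_ + _).
    by apply: eq_bigr => i _; rewrite c'E.
  by split => [i|]; [rewrite -c'E|rewrite -c'v].
have [|M M0 HM] := IH e'.
  move=> c c0; have [] // := ie' c 0.
  by rewrite scale0r addr0.
have combB (c c' : 'I_n -> K) : comb (fun i => c i - c' i) = comb c - comb c'.
  by rewrite /comb -sumrB; apply: eq_bigr => i _; rewrite scalerBl.
have combZ (b : K) (c : 'I_n -> K) : comb (fun i => b * c i) = b *: comb c.
  by rewrite /comb scaler_sumr; apply: eq_bigr => i _; rewrite scalerA.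
have NN u : N (- u) = N u.
  by rewrite -scaleN1r N_scale modulusN modulus1 mul1r.
have [D D0 ND] := quasi_norm_sum n.
have [d d0 Hd] : exists2 d : R, 0 < d & forall c, d <= N (comb c + v).
  (* Otherwise combinations [comb (c m)] approach [- v]. Their coordinates are Cauchy by the
     induction hypothesis, and the limit [z] satisfies [comb z + v = 0], a relation in which [v] has
     coefficient 1. *)
  apply: contrapT => nd.
  have /choice[c Hc] : forall m : nat, exists c, N (comb c + v) < m.+1%:R^-1.
    move=> m; apply: contrapT => nc; apply: nd; exists m.+1%:R^-1 => // c.
    by rewrite leNgt; apply/negP => ?; apply: nc; exists c.
  have dist_c m l i :
      modulus (c m i - c l i) <= M * (C * (m.+1%:R^-1 + l.+1%:R^-1)).
    apply: le_trans (HM (fun i => c m i - c l i) i) _.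
    apply: ler_wpM2l => //; rewrite -/(comb _) combB.
    have -> : comb (c m) - comb (c l) = (comb (c m) + v) + - (comb (c l) + v).
      by rewrite opprD addrACA subrr addr0.
    apply: le_trans (N_add _ _) _; apply: ler_wpM2l => //.
    by rewrite NN lerD// ltW.
  have /choice[z Hz] i : exists z : K, modulus (c m i - z) @[m --> \oo] --> 0.
    apply: scalar_cauchy_cvg => e0 e00.
    (* The summand 1 keeps the denominator positive when [M * C] is 0. *)
    have P : 0 < e0 / (M * C * 2 + 1).
      by rewrite divr_gt0// ltr_wpDl// !mulr_ge0.
    have [L _ HL] := near_infty_natSinv_lt (PosNum P).
    exists L => m l Lm Ll; apply: le_trans (dist_c m l i) _.
    have m1 : m.+1%:R^-1 < e0 / (M * C * 2 + 1) := HL m Lm.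
    have l1 : l.+1%:R^-1 < e0 / (M * C * 2 + 1) := HL l Ll.
    rewrite mulrA; apply: (@le_trans _ _ (M * C * (e0 / (M * C * 2 + 1) * 2))).
      by apply: ler_wpM2l; [exact: mulr_ge0|rewrite mulr_natr mulr2n lerD// ltW].
    have MC : 0 <= M * C by exact: mulr_ge0.
    rewrite (_ : _ * _ = e0 * (M * C * 2) / (M * C * 2 + 1)); last by ring.
    rewrite ler_pdivrMr; last by lra.
    by apply: ler_wpM2l; [exact: ltW|lra].
  have lim0 : C * (m.+1%:R^-1 + D * \sum_i (modulus (c m i - z i) * N (e' i)))
      @[m --> \oo] --> (0 : R).
    rewrite -[X in _ --> X](mulr0 C); apply: cvgM; first exact: cvg_cst.
    rewrite -[X in _ --> X](addr0 0); apply: cvgD.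
      exact: cvg_harmonic.
    rewrite -[X in _ --> X](mulr0 D); apply: cvgM; first exact: cvg_cst.
    rewrite [X in _ --> X](_ : 0 = \sum_(i < n) 0 * N (e' i)); last first.
      by rewrite big1// => i _; rewrite mul0r.
    apply: cvg_sum_ord => i.
    by apply: cvgM; [exact: Hz|exact: cvg_cst].
  (* A quasi-norm need not be continuous, so the limit is reached by bounding this fixed value by a
     sequence that tends to 0. *)
  have : N (comb z + v) <= 0.
    apply: (cvgr_to_ge lim0); near=> m.
    have -> : comb z + v = (comb (c m) + v) + - comb (fun i => c m i - z i).
      by rewrite combB opprB [RHS]addrC addrA subrK.
    apply: le_trans (N_add _ _) _; apply: ler_wpM2l => //.
    apply: lerD; first exact: ltW.
    rewrite NN; apply: le_trans (ND _) _; apply: ler_wpM2l => //.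
    by apply: ler_sum => i _; rewrite N_scale.
  move=> N0; have : N (comb z + v) = 0 by apply/eqP; rewrite eq_le N0 N_ge0.
  rewrite -(scale1r v) => /N_eq0/ie'[_ /eqP]; by rewrite oner_eq0.
have Nv := N_ge0 v.
(* The first term bounds the last coordinate and the second the remaining ones; the sum serves
   both. *)
exists (d^-1 + M * (C * (1 + d^-1 * N v))).
  by rewrite addr_ge0 ?invr_ge0 ?(ltW d0)// !mulr_ge0// addr_ge0// mulr_ge0// invr_ge0 ltW.
move=> c i; rewrite big_ord_recr /= -/v.
set b := c ord_max; pose c0 j := c (widen_ord (leqnSn n) j).
rewrite -/(comb c0); set s := comb c0 + b *: v.
have Ns := N_ge0 s.
have Hb : modulus b <= d^-1 * N s.
  have [->|b0] := eqVneq b 0; first by rewrite modulus0 mulr_ge0// invr_ge0 ltW.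
  rewrite ler_pdivlMl//.
  have -> : s = b *: (comb (fun j => b^-1 * c0 j) + v).
    by rewrite combZ scalerDr scalerA mulfV// scale1r.
  by rewrite N_scale [leLHS]mulrC; apply: ler_wpM2l; [exact: modulus_ge0|exact: Hd].
have Hc j : modulus (c0 j) <= M * (C * (1 + d^-1 * N v)) * N s.
  apply: le_trans (HM c0 j) _; rewrite -mulrA; apply: ler_wpM2l => //.
  rewrite -/(comb c0) (_ : comb c0 = s - b *: v); last by rewrite addrK.
  apply: le_trans (N_add _ _) _; rewrite -mulrA; apply: ler_wpM2l => //.
  rewrite NN N_scale mulrDl mul1r lerD2l mulrAC.
  exact: ler_wpM2r.
rewrite mulrDl; case: (unliftP ord_max i) => [j ->|->].
  have -> : lift ord_max j = widen_ord (leqnSn n) j.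
    by apply: val_inj => /=; rewrite /bump leqNgt ltn_ord.
  by apply: le_trans (Hc j) _; rewrite lerDr mulr_ge0// invr_ge0 ltW.
apply: le_trans Hb _; rewrite lerDl !mulr_ge0//.
by rewrite addr_ge0// mulr_ge0// invr_ge0 ltW.
Unshelve. all: by end_near. Qed.

End quasi_norm.

(** * Perturbation estimates and uniformly small tails in [Lq] *)

Section Lq_quasi_norm.
Context (R : realType) (k : scalars) (W : interval_weight R) (q : {posnum R}).
Local Notation K := (scalar R k).
Local Notation Y := (Lq k W q).
Local Open Scope ring_scope.

Lemma ler_powR_inj (r x y : R) : 0 < r -> 0 <= x -> 0 <= y ->
  x `^ r <= y `^ r -> x <= y.
Proof.
move=> r0 x0 y0 xy; rewrite leNgt; apply/negP => yx.
have := gt0_ltr_powR r0 y0 x0 yx.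
by rewrite ltNge xy.
Qed.

(* Replaces the triangle inequality for all [q] at once: a small summand
   increases the norm only a little. *)
Lemma Lq_norm_add_small (g rho : R) : 0 <= g -> g < rho ->
  exists2 e : R, 0 < e & forall h1 h2 : Y,
    Lq_norm h1 <= g -> Lq_norm h2 <= e -> Lq_norm (h1 + h2) <= rho.
Proof.
move=> g0 grho; have rho0 : 0 < rho := le_lt_trans g0 grho.
(* With this choice [(1 - t)^-1 * g] equals [2 * rho * g / (rho + g)], which is still below
   [rho]. *)
pose t := (rho - g) / (2 * rho).
have t0 : 0 < t by rewrite divr_gt0 ?subr_gt0// mulr_gt0.
have t1E : 1 - t = (rho + g) / (2 * rho) by rewrite /t; field; rewrite gt_eqF.
have t1' : 0 < 1 - t by rewrite t1E divr_gt0 ?mulr_gt0// ltr_wpDr.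
have t01 : 0 < t < 1 by rewrite t0 -subr_gt0.
pose s := (1 - t)^-1 * g.
have s0 : 0 <= s by rewrite mulr_ge0// invr_ge0 ltW.
have srho : s < rho.
  rewrite /s ltr_pdivrMl// t1E.
  have -> : (rho + g) / (2 * rho) * rho = (rho + g) / 2.
    by field; rewrite gt_eqF.
  by lra.
have d0 : 0 < rho `^ q%:num - s `^ q%:num.
  by rewrite subr_gt0 gt0_ltr_powR// nnegrE ltW.
(* Chosen so that [(t^-1 * e) ^ q] is exactly the room left between [s ^ q] and [rho ^ q]. *)
exists (t * (rho `^ q%:num - s `^ q%:num) `^ q%:num^-1).
  by rewrite mulr_gt0// powR_gt0.
move=> h1 h2 h1g h2e; apply: (@ler_powR_inj q%:num); rewrite ?Lq_norm_ge0 ?(ltW rho0)//.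
apply: le_trans (Lq_norm_powRD h1 h2 t01) _.
rewrite -[leRHS](subrKC (s `^ q%:num)); apply: lerD.
  apply: ge0_ler_powR; rewrite ?nnegrE//.
    by rewrite mulr_ge0 ?Lq_norm_ge0// invr_ge0 ltW.
  by apply: ler_wpM2l; rewrite // invr_ge0 ltW.
have -> : rho `^ q%:num - s `^ q%:num =
    ((rho `^ q%:num - s `^ q%:num) `^ q%:num^-1) `^ q%:num.
  by rewrite -powRrM mulVf// powRr1// ltW.
apply: ge0_ler_powR; rewrite ?nnegrE ?powR_ge0//.
  by rewrite mulr_ge0 ?Lq_norm_ge0// invr_ge0 ltW.
by rewrite ler_pdivrMl.
Qed.

Lemma Lq_norm_quasi_triangle : exists2 C : R, 0 <= C &
  forall h1 h2 : Y, Lq_norm (h1 + h2) <= C * (Lq_norm h1 + Lq_norm h2).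
Proof.
have C0 : 0 <= 2 `^ q%:num^-1 * 2 :> R by rewrite mulr_ge0// powR_ge0.
(* At [t = 1/2] both terms are at most the [q]-th power of twice the sum of the norms; the other
   factor is the [q]-th root of the number 2 of terms. *)
exists (2 `^ q%:num^-1 * 2) => // h1 h2.
have N1 := Lq_norm_ge0 h1; have N2 := Lq_norm_ge0 h2.
have N12 := addr_ge0 N1 N2.
apply: (@ler_powR_inj q%:num); rewrite ?Lq_norm_ge0 ?mulr_ge0//.
have t01 : 0 < (2^-1 : R) < 1 by lra.
apply: le_trans (Lq_norm_powRD h1 h2 t01) _.
have -> : 1 - 2^-1 = 2^-1 :> R by lra.
rewrite invrK -mulrA [leRHS]powRM ?powR_ge0 ?mulr_ge0//.
rewrite -powRrM mulVf// powRr1// [leRHS]mulr_natl mulr2n.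
by apply: lerD; apply: ge0_ler_powR; rewrite ?nnegrE ?mulr_ge0//;
  rewrite ler_pM2l// ?lerDl ?lerDr.
Qed.

Lemma Lq_coord_bound n (e : 'I_n -> Y) : lin_indep e ->
  exists2 M : R, 0 <= M & forall (c : 'I_n -> K) i,
    modulus (c i) <= M * Lq_norm (\sum_j c j *: e j).
Proof.
have [C C0 NC] := Lq_norm_quasi_triangle.
exact: (lin_indep_coord_bound (@Lq_norm_ge0 _ _ _ _) (@Lq_normZ _ _ _ _)
  (@Lq_norm0_eq0 _ _ _ _) C0 NC).
Qed.

(** Elements of [U] of norm at most [B] have coordinates at most [M * B], so a single combination of
    the tails of the basis vectors dominates all their tails, and one index [n] suffices. *)
Lemma finite_dim_uniform_tail (U : set Y) (B : R) (c d : R^nat) :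
  finite_dim U ->
  (forall x, dom W x -> \forall n \near \oo, ~ outer_set W (c n) (d n) x) ->
  forall e : R, 0 < e -> exists n, forall h, U h -> Lq_norm h <= B ->
    Lq_norm (chi (measurable_outer_set W (c n) (d n)) h) <= e.
Proof.
move=> [n [b [ib bU]]] cd0 e e0.
have [M M0 HM] := Lq_coord_bound ib.
have [C C0 NC] := Lq_norm_quasi_triangle.
have [D D0 HD] := quasi_norm_sum (@Lq_norm_ge0 _ k W q) (@Lq_normZ _ _ _ _) C0 NC n.
pose A m := measurable_outer_set W (c m) (d m).
have lim0 : D * \sum_(i < n) M * B * Lq_norm (chi (A m) (b i))
    @[m --> \oo] --> (0 : R).
  rewrite -[X in _ --> X](mulr0 D); apply: cvgM; first exact: cvg_cst.
  rewrite [X in _ --> X](_ : 0 = \sum_(i < n) M * B * 0); last first.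
    by rewrite big1// => i _; rewrite mulr0.
  apply: cvg_sum_ord => i; apply: cvgM; first exact: cvg_cst.
  exact: cvg_Lq_norm_chi.
have [m _ /(_ m (leqnn m)) /= me] := cvgr_le _ lim0 _ e0.
exists m => h Uh hB; apply: le_trans me.
move: Uh; rewrite -bU => -[n' [a [f [fb hE]]]].
(* An element of [lin_span] may use a basis vector several times; its coefficients are collected by
   index. *)
have [a' ha'] : exists a' : 'I_n -> K, h = \sum_i a' i *: b i.
  have /choice[j jE] i : exists j, b j = f i by have [j _ <-] := fb i; exists j.
  exists (fun i => \sum_(l < n' | j l == i) a l).
  rewrite hE (partition_big j xpredT)//=; apply: eq_bigr => i _.
  rewrite scaler_suml; apply: eq_bigr => l /eqP <-.
  by rewrite jE.
rewrite ha' chi_sum; apply: le_trans (HD _) _; apply: ler_wpM2l => //.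
apply: ler_sum => i _; rewrite chiZ Lq_normZ.
apply: ler_wpM2r; first exact: Lq_norm_ge0.
apply: le_trans (HM a' i) _; apply: ler_wpM2l => //.
by rewrite -ha'.
Qed.

End Lq_quasi_norm.

(** * The two inequalities between [dist_fr] and [tau] *)

Section operator_norm.
Context (R : realType) (k : scalars) (W : interval_weight R) (q : {posnum R}).
Local Notation K := (scalar R k).
Local Notation Y := (Lq k W q).
Context (E1 E2 : normedModType K).
Implicit Types T F G : E1 -> E2 -> Y.

Lemma opnorm_leP G (r : R) : opnorm G <= r%:E <->
  (forall x1 x2, (`|x1| <= 1)%R -> (`|x2| <= 1)%R ->
    (Lq_norm (G x1 x2) <= r)%R).
Proof.
split=> [Gr x1 x2 x11 x21|Gr].
  rewrite -lee_fin; apply: le_trans Gr; apply: ereal_sup_ubound.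
  by exists (G x1 x2) => //; exists x1 => //; exists x2.
by apply: ge_ereal_sup => _ [_ [x1 x11 [x2 x21 <-]] <-]; rewrite lee_fin; exact: Gr.
Qed.

Lemma opnorm_ge0 G : 0 <= opnorm G.
Proof.
apply: (@le_trans _ _ (Lq_norm (G 0%R 0%R))%:E); first by rewrite lee_fin Lq_norm_ge0.
apply: ereal_sup_ubound; exists (G 0%R 0%R) => //.
by exists 0%R; rewrite /= ?normr0//; exists 0%R; rewrite /= ?normr0.
Qed.

(** The form in which [Lq_norm_add_small] is applied: it needs a bound [rho] strictly above the
    norm, and [rho] is then let down to it. *)
Lemma le_opnorm G (x : \bar R) :
  (forall rho : R, opnorm G < rho%:E -> x <= rho%:E) -> x <= opnorm G.
Proof.
move=> H; case EG : (opnorm G) => [g| |].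
- apply/lee_addgt0Pr => e e0; rewrite -EFinD; apply: H.
  by rewrite EG lte_fin ltrDl.
- exact: leey.
- by have := opnorm_ge0 G; rewrite EG.
Qed.

Lemma opnorm_lt_fin G (rho : R) : opnorm G < rho%:E ->
  exists g : R, [/\ opnorm G = g%:E, (0 <= g)%R & (g < rho)%R].
Proof.
move=> Grho; have G0 := opnorm_ge0 G.
have Gf : opnorm G \is a fin_num by rewrite ge0_fin_numE// (lt_trans Grho) ?ltry.
exists (fine (opnorm G)); rewrite fineK//; split => //.
  exact: fine_ge0.
by rewrite -lte_fin fineK.
Qed.

Lemma dist_fr_le_tau T :
  (forall c d : R, lep W < c%:E -> (c < d)%R -> d%:E < rep W ->
     op_closure (@finite_rank R k W q E1 E2) (inner_restr c d T)) ->
  dist_fr T <= tau T.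
Proof.
move=> hcl; apply: le_ereal_inf_tmp => _ [[c d] /= [/= ac cd db] <-].
rewrite /gamma; apply: le_opnorm => rho /opnorm_lt_fin[g [gE g0 grho]].
have [e e0 He] := Lq_norm_add_small k W q g0 grho.
have [_ /(_ e e0)[F frF Fe]] := hcl c d ac cd db.
apply: (@le_trans _ _ (opnorm (map_sub T F))).
  by apply: ereal_inf_lbound; exists F.
apply/opnorm_leP => x1 x2 x11 x21.
(* The outer part has norm at most [g], and the error of approximating the inner part by [F] is the
   small summand. *)
have -> : (map_sub T F x1 x2 = chi (measurable_outer_set W c d) (T x1 x2) +
    map_sub (inner_restr c d T) F x1 x2)%R.
  by rewrite /map_sub addrA; congr (_ - _)%R; rewrite addrC chi_inner_outer.
apply: He; first by move: x1 x2 x11 x21; apply/opnorm_leP; rewrite gE.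
by move: x1 x2 x11 x21; apply/opnorm_leP; exact: ltW.
Qed.

Lemma tau_le_dist_fr T : tau T <= dist_fr T.
Proof.
apply: le_ereal_inf_tmp => _ [F [[_ bF] fdF] <-].
apply: le_opnorm => rho /opnorm_lt_fin[g [gE g0 grho]].
have [e e0 He] := Lq_norm_add_small k W q g0 grho.
have [c [d [cd cd0]]] := dom_exhaustion W.
(* Boundedness of [F] makes its norm a real number [B]; adding 1 only provides the strict
   inequality. *)
have /opnorm_lt_fin[B [BE _ _]] : opnorm F < (fine (opnorm F) + 1)%:E.
  rewrite -[ltLHS]fineK; first by rewrite lte_fin ltrDl.
  by rewrite ge0_fin_numE// opnorm_ge0.
have [n Hn] := finite_dim_uniform_tail B fdF cd0 e0.
apply: (@le_trans _ _ (gamma (c n) (d n) T)).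
  by apply: ereal_inf_lbound; exists (c n, d n).
apply/opnorm_leP => x1 x2 x11 x21.
have -> : T x1 x2 = (map_sub T F x1 x2 + F x1 x2)%R by rewrite /map_sub subrK.
(* Cutting off does not increase the norm of [T - F], and the tail of [F] is the small summand,
   uniformly on the unit balls. *)
rewrite chiD; apply: He.
  apply: le_trans (Lq_norm_chi_le _ _) _.
  by move: x1 x2 x11 x21; apply/opnorm_leP; rewrite gE.
apply: Hn; last by move: x1 x2 x11 x21; apply/opnorm_leP; rewrite BE.
exists 1%N, (fun=> 1%R), (fun=> F x1 x2); split.
  by move=> _; exists x1 => //; exists x2.
by rewrite big_ord1 scale1r.
Qed.

End operator_norm.

(** * Infima under powers and under a rank bound *)

Lemma ereal_inf_poweR (R : realType) (S : set (\bar R)) (r : R) :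
  (0 < r)%R -> S `<=` [set x | 0 <= x] ->
  ereal_inf [set x `^ r | x in S] = ereal_inf S `^ r.
Proof.
move=> r0 S0; have inf0 : 0 <= ereal_inf S by exact: le_ereal_inf_tmp.
have r0' := ltW r0.
apply/eqP; rewrite eq_le; apply/andP; split; last first.
  apply: le_ereal_inf_tmp => _ [x Sx <-].
  apply: gt0_ler_poweR => //; rewrite ?in_itv/= ?leey ?andbT//.
  - exact: S0.
  - exact: ereal_inf_lbound.
pose m := ereal_inf [set x `^ r | x in S].
have m0 : 0 <= m by apply: le_ereal_inf_tmp => _ [x _ <-]; exact: poweR_ge0.
(* Taking [r]-th roots reduces the bound to [m ^ (1/r) <= ereal_inf S], which is checked
   elementwise. *)
have mE : m = (m `^ r^-1) `^ r.
  by rewrite -poweRrM mulVf ?gt_eqF// poweRe1.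
rewrite -/m mE; apply: gt0_ler_poweR; rewrite ?in_itv/= ?leey ?poweR_ge0 ?inf0//.
apply: le_ereal_inf_tmp => x Sx.
have x0 := S0 _ Sx.
have -> : x = (x `^ r) `^ r^-1 by rewrite -poweRrM mulfV ?gt_eqF// poweRe1.
apply: gt0_ler_poweR; rewrite ?invr_ge0 ?in_itv/= ?leey ?poweR_ge0 ?m0//.
by apply: ereal_inf_lbound; exists x.
Qed.

Section approximation_limit.
Context (R : realType) (T : Type) (rk : T -> nat) (f : T -> \bar R) (A : set T).

Lemma cvg_inf_rank :
  ereal_inf [set f F | F in [set F | A F /\ (rk F < n)%N]] @[n --> \oo] -->
  ereal_inf [set f F | F in A].
Proof.
set u := fun n : nat => _.
have -> : ereal_inf [set f F | F in A] = ereal_inf (range u).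
  apply/eqP; rewrite eq_le; apply/andP; split.
    apply: le_ereal_inf_tmp => _ [n _ <-]; apply: ereal_inf_le_tmp.
    by move=> _ [F [AF _] <-]; exists F.
  apply: le_ereal_inf_tmp => _ [F AF <-].
  (* The rank bound is strict, so [F] first competes at index [(rk F).+1]. *)
  apply: (@le_trans _ _ (u (rk F).+1)).
    by apply: ereal_inf_lbound; exists (rk F).+1.
  by apply: ereal_inf_lbound; exists F.
apply: ereal_nonincreasing_cvgn => m n mn; apply: ereal_inf_le_tmp.
by move=> _ [F [AF Fm] <-]; exists F => //; split => //; exact: leq_trans mn.
Qed.

End approximation_limit.

(** * Distance to finite rank, its powered form and the limits of approximation numbers *)

Theorem theorem5p3 (R : realType) (k : scalars) (W : interval_weight R) (q : {posnum R})
    (E1 E2 : normedModType (scalar R k)) (T : E1 -> E2 -> Lq k W q)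
    (hT : bounded_bilinear T)
    (hcompact : forall c d : R, lep W < c%:E -> (c < d)%R -> d%:E < rep W ->
       compact_map (inner_restr c d T))
    (hclosure : forall c d : R, lep W < c%:E -> (c < d)%R -> d%:E < rep W ->
       op_closure (@finite_rank R k W q E1 E2) (inner_restr c d T)) :
  [/\ dist_fr T = tau T,
      dist_fr_theta T = tau T `^ theta q,
      approx_number n T @[n --> \oo] --> dist_fr T &
      approx_number_theta n T @[n --> \oo] --> dist_fr_theta T].
Proof.
have distE : dist_fr T = tau T.
  by apply/eqP; rewrite eq_le dist_fr_le_tau// tau_le_dist_fr.
split => //; last 2 first.
- exact: cvg_inf_rank.
- exact: cvg_inf_rank.
have theta0 : (0 < theta q)%R by rewrite lt_min ltr01 gt0.
(* A positive power commutes with the infimum of nonnegative values, so the powered identity follows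
   from the plain one. *)
rewrite -distE -(@ereal_inf_poweR _ _ _ theta0).
  by rewrite /dist_fr_theta image_comp.
by move=> _ [F _ <-]; exact: opnorm_ge0.
Qed.
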